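(* Let $a_1,\dots,a_m\in\mathbb{R}^n$ be vectors that span $\mathbb{R}^n$, let $y_1,\dots,y_m\in\mathbb{R}$, and consider the phase retrieval objective $f:\mathbb{R}^n\to\mathbb{R}$, $$f(x)=\frac14\sum_{i=1}^m\big(y_i^2-(a_i^\top x)^2\big)^2 .$$ Then: (i) For any $L_1>0$ there exists $L_0>0$ such that $f$ is $(L_0,L_1)$-smooth. (ii) If $\phi$ is a reference function on $\mathbb{R}^n$ satisfying conditions (S) and (I) given in the context, then for any $\bar L>0$ there exists an $L>0$ such that $f$ satisfies the second-order characterization of $(L,\bar L)$-anisotropic smoothness relative to $\phi$.
   Context: $\|\cdot\|$ is the Euclidean norm on vectors and the spectral norm on matrices; $\mathbb{R}_+=[0,\infty)$. A twice continuously differentiable $f:\mathbb{R}^n\to\mathbb{R}$ is $(L_0,L_1)$-smooth, with $L_0,L_1\ge0$, if $\|\nabla^2 f(x)\|\le L_0+L_1\|\nabla f(x)\|$ for all $x$. Standing assumption: a reference function is a function $\phi:\mathbb{R}^n\to\overline{\mathbb{R}}$ that is proper, lower semicontinuous, strongly convex and even, with $\phi(0)=0$; $\phi^*$ is its convex conjugate. $f$ satisfies the second-order characterization of $(L,\bar L)$-anisotropic smoothness relative to $\phi$ if $\lambda_{\max}(\nabla^2\phi^*(\bar L^{-1}\nabla f(x))\nabla^2 f(x))\le L\bar L$ for all $x\in\mathbb{R}^n$. Condition (S): $\operatorname{int}\operatorname{dom}\phi\ne\emptyset$; $\phi\in\mathcal{C}^2(\operatorname{int}\operatorname{dom}\phi)$;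 and for any sequence $(x^k)$ converging to some boundary point of $\operatorname{int}\operatorname{dom}\phi$, $\|\nabla\phi(x^k)\|\to\infty$. (This ensures in particular $\phi^*\in\mathcal{C}^2(\mathbb{R}^n)$.) Condition (I): $\phi$ is isotropic, i.e. $\phi(x)=h(\|x\|)$ for a scalar kernel function $h:\mathbb{R}\to\mathbb{R}_+\cup\{\infty\}$, and, with $h^*$ the convex conjugate of $h$: (i) ${h^*}'(y)/y$ is a decreasing function on $\mathbb{R}_+$; (ii) $\lim_{y\to+\infty}y\,{h^*}''(y)=C_2$ for some $C_2\in\mathbb{R}_+$; (iii) $\lim_{y\to+\infty}{h^*}'(s_d(y))/y=0$ for any polynomial $s_d(\alpha)=\sum_{i=0}^d u_i\alpha^i$ of degree $d$. *)

(* Defs.v *)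
From HB Require Import structures.
From mathcomp Require Import all_boot all_order all_algebra.
From mathcomp Require Import all_classical all_reals all_analysis.

Set Implicit Arguments.
Unset Strict Implicit.
Unset Printing Implicit Defensive.

Import Order.TTheory GRing.Theory Num.Theory.
Import numFieldNormedType.Exports.

Local Open Scope classical_set_scope.
Local Open Scope ring_scope.

(* Vectors of R^n are row vectors.  The norm `|x| carried by 'rV[R]_n in the
   library is the sup norm: it is used only through the topology it induces
   (limits, differentiability), the Euclidean norm being [enorm]. *)

Section Euclidean.
Variables (R : realType) (n : nat).

Definition dotp (x y : 'rV[R]_n) : R := \sum_(i < n) x 0 i * y 0 i.

Definition enorm (x : 'rV[R]_n) : R := Num.sqrt (dotp x x).

(* A acts on the right on row vectors; A and its transpose have the same
   spectral norm. *)
Definition spectral_norm (A : 'M[R]_n) : R :=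
  sup [set enorm (x *m A) | x in [set x : 'rV[R]_n | enorm x <= 1]].

(* The largest real eigenvalue.  It is applied to a product of a positive
   semidefinite matrix with a symmetric one, all of whose complex eigenvalues
   are real. *)
Definition lambda_max (A : 'M[R]_n) : R := sup [set r : R | eigenvalue A r].

End Euclidean.

Section Derivatives.
Variables (R : realType) (n : nat).

Definition grad (g : 'rV[R]_n -> R) (x : 'rV[R]_n) : 'rV[R]_n :=
  \row_(i < n) 'D_(delta_mx 0 i) g x.

(* (hess g x) i j = D_i (D_j g) x *)
Definition hess (g : 'rV[R]_n -> R) (x : 'rV[R]_n) : 'M[R]_n :=
  jacobian (grad g) x.

(* Meant for an open set U. *)
Definition C2_on (U : set 'rV[R]_n) (g : 'rV[R]_n -> R) : Prop :=
  forall x, U x -> [/\ differentiable g x,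
                       differentiable (grad g) x &
                       {for x, continuous (hess g)}].

Definition L0L1_smooth (L0 L1 : R) (g : 'rV[R]_n -> R) : Prop :=
  [/\ 0 <= L0, 0 <= L1, C2_on setT g &
      forall x, spectral_norm (hess g x) <= L0 + L1 * enorm (grad g x)].

End Derivatives.

(* Convex conjugate with respect to the pairing p. *)
Definition conjugate (R : realType) (T : Type) (p : T -> T -> R)
    (g : T -> \bar R) (y : T) : \bar R :=
  ereal_sup [set ((p x y)%:E - g x)%E | x in [set: T]].

Section Reference.
Variables (R : realType) (n : nat).
Implicit Type phi : 'rV[R]_n -> \bar R.

Definition edom phi : set 'rV[R]_n := [set x | (phi x < +oo)%E].

Definition proper phi : Prop :=
  (forall x, phi x != -oo%E) /\ edom phi !=set0.

(* Only used for functions that do not take the value -oo. *)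
Definition econvex phi : Prop :=
  forall (x y : 'rV[R]_n) (t : R), 0 < t -> t < 1 ->
    (phi (t *: x + (1 - t) *: y)%R <= t%:E * phi x + (1 - t)%:E * phi y)%E.

Definition strongly_convex phi : Prop :=
  exists mu : R, 0 < mu /\
    econvex (fun x => phi x - (mu / 2 * enorm x ^+ 2)%:E)%E.

Definition reference_function phi : Prop :=
  [/\ proper phi, lower_semicontinuous phi, strongly_convex phi,
      (forall x, phi (- x) = phi x) & phi 0 = 0%E].

(* The conjugate of a reference function is finite everywhere, because of
   strong convexity. *)
Definition conj_fun phi (y : 'rV[R]_n) : R :=
  fine (conjugate (@dotp R n) phi y).

Definition condS phi : Prop :=
  let U := interior (edom phi) in
  let g := fun x => fine (phi x) in
  [/\ U !=set0,
      C2_on U g &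
      forall (u : nat -> 'rV[R]_n) (b : 'rV[R]_n),
        (forall k, U (u k)) ->
        (closure U `\` interior U) b ->
        u @ \oo --> b ->
        enorm (grad g (u k)) @[k --> \oo] --> +oo].

(* Since h >= 0 and h 0 = phi 0 = 0, the values of h^* on [0, +oo[ do not
   depend on h on negative numbers.  In the monotonicity condition y ranges
   over y > 0, the quotient being meaningless at 0, and "decreasing" is
   understood in the wide sense. *)
Definition condI phi : Prop :=
  exists h : R -> \bar R,
    let hs := fun y : R => fine (conjugate *%R h y) in
    [/\ (forall t, 0 <= h t)%E /\ (forall x, phi x = h (enorm x)),
        (forall y z : R, 0 < y -> y <= z -> derive1 hs z / z <= derive1 hs y / y),
        (exists C2 : R, 0 <= C2 /\ y * derive1n 2 hs y @[y --> +oo] --> C2) &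
        (forall s : {poly R}, derive1 hs s.[y] / y @[y --> +oo] --> (0 : R))].

Definition aniso_smooth2 (L Lbar : R) phi (f : 'rV[R]_n -> R) : Prop :=
  forall x, lambda_max (hess (conj_fun phi) (Lbar^-1 *: grad f x) *m hess f x)
            <= L * Lbar.

End Reference.

Definition phase_retrieval (R : realType) (n m : nat)
    (a : 'I_m -> 'rV[R]_n) (y : 'I_m -> R) (x : 'rV[R]_n) : R :=
  4^-1 * \sum_(i < m) (y i ^+ 2 - dotp (a i) x ^+ 2) ^+ 2.

(* Main.v *)
Require Import Defs.
From HB Require Import structures.
From mathcomp Require Import all_boot all_order all_algebra.
From mathcomp Require Import all_classical all_reals all_analysis.
From mathcomp Require Import ring lra.

Set Implicit Arguments.
Unset Strict Implicit.
Unset Printing Implicit Defensive.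

Import Order.TTheory GRing.Theory Num.Theory.
Import numFieldNormedType.Exports.

Local Open Scope classical_set_scope.
Local Open Scope ring_scope.

(** Both claims compare growth rates at infinity.  The gradient of the phase
    retrieval objective f is a sum of cubics in the measurements
    [dotp (a i) x]; as the [a i] span the space, the measurements control the
    norm t of x, and testing the gradient against x gives
    |grad f x| >= c t^3 - D t ([grad_phase_retrieval_ge]).  The Hessian is
    quadratic: |hess f x| <= A t^2 + B ([hess_phase_retrieval_le]).  Hence for
    every L1 > 0 the cubic L1 |grad f x| absorbs the Hessian outside a ball,
    and L0 pays for the ball: this is (i).

    For (ii), isotropy makes the conjugate of phi radial: it is k(|v|), where k
    is the conjugate of the kernel h.  The gradient is then (k'(r)/r) v with
    r = |v|, and the Hessian has the eigenvalues k''(r) in the direction of v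
    and k'(r)/r orthogonally ([hess_radial]).  Every eigenvalue of the product
    of the two Hessians is at most the product of their operator norms, so it
    suffices to bound max(|k''(r)|, k'(r)/r) (A t^2 + B) where r is
    |grad f x| / Lbar.
    - For bounded t, strong convexity of phi is used: its conjugate is convex
      with second differences at most |d|^2/mu, so k' is Lipschitz with
      k'(r) = O(r), and both quantities are bounded by a constant
      ([conjugate_kernel_C11], [reference_conjugate_radial]).
    - For large t, r >= c' t^3.  Since r k''(r) converges, k''(r) = O(t^-3).
      Since k'(r)/r decreases, it is at most k'(c' t^3)/(c' t^3), which is
      O(t^-2) by the growth condition applied to the polynomial c' X^3.  Both
      decay at least as fast as the Hessian of f grows.

    The Lipschitz bound controls k'' wherever it exists, and differentiability
    of the gradient of the conjugate at v forces k'' to exist at |v|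
    ([derive1_radial_derivable]); where that gradient is not differentiable its
    Jacobian has the default value 0 ([jacobian_default]), so that the bounds
    hold there as well. *)

(** * Euclidean norm and operator bounds *)

Section EuclideanTheory.
Context {R : realType} {n : nat}.
Implicit Types (x y z u v : 'rV[R]_n) (t : R).

Lemma dotpC x y : dotp x y = dotp y x.
Proof. by apply: eq_bigr => i _; rewrite mulrC. Qed.

Lemma dotpDr x y z : dotp x (y + z) = dotp x y + dotp x z.
Proof. by rewrite -big_split; apply: eq_bigr => i _; rewrite mxE mulrDr. Qed.

Lemma dotpZr t x y : dotp x (t *: y) = t * dotp x y.
Proof. by rewrite mulr_sumr; apply: eq_bigr => i _; rewrite mxE mulrCA. Qed.

Lemma dotpDl x y z : dotp (x + y) z = dotp x z + dotp y z.
Proof. by rewrite dotpC dotpDr !(dotpC z). Qed.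

Lemma dotpZl t x y : dotp (t *: x) y = t * dotp x y.
Proof. by rewrite dotpC dotpZr dotpC. Qed.

Lemma dotp0l x : dotp 0 x = 0.
Proof. by apply: big1 => i _; rewrite mxE mul0r. Qed.

Lemma dotp_suml m (F : 'I_m -> 'rV[R]_n) x :
  dotp (\sum_(i < m) F i) x = \sum_(i < m) dotp (F i) x.
Proof.
by apply: (big_ind2 (fun u c => dotp u x = c)) => //= [|? ? ? ? <- <-];
  rewrite (dotp0l, dotpDl).
Qed.

Lemma dotp_delta x i : dotp x (delta_mx 0 i) = x 0 i.
Proof.
rewrite /dotp (bigD1 i)//= mxE !eqxx mulr1 big1 ?addr0// => j ji.
by rewrite mxE (negbTE ji) andbF mulr0.
Qed.

Lemma dotp_ge0 x : 0 <= dotp x x.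
Proof. by apply: sumr_ge0 => i _; rewrite -expr2 sqr_ge0. Qed.

Lemma dotp_eq0 x : (dotp x x == 0) = (x == 0).
Proof.
apply/idP/eqP => [|->]; last by rewrite dotp0l.
rewrite psumr_eq0 => [/allP H|i _]; last by rewrite -expr2 sqr_ge0.
apply/rowP => i; rewrite mxE; apply/eqP.
by rewrite -sqrf_eq0 expr2; apply: H; rewrite mem_index_enum.
Qed.

Lemma enorm_ge0 x : 0 <= enorm x. Proof. exact: sqrtr_ge0. Qed.

Lemma enormK x : enorm x ^+ 2 = dotp x x.
Proof. by rewrite sqr_sqrtr// dotp_ge0. Qed.

Lemma enorm_eq0 x : (enorm x == 0) = (x == 0).
Proof. by rewrite -dotp_eq0 -enormK sqrf_eq0. Qed.

Lemma enorm0 : enorm (0 : 'rV[R]_n) = 0.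
Proof. by apply/eqP; rewrite enorm_eq0. Qed.

Lemma enormZ t x : enorm (t *: x) = `|t| * enorm x.
Proof. by rewrite /enorm dotpZl dotpZr mulrA -expr2 sqrtrM ?sqr_ge0// sqrtr_sqr. Qed.

Lemma enorm_delta i : enorm (delta_mx 0 i : 'rV[R]_n) = 1.
Proof. by rewrite /enorm dotp_delta mxE !eqxx sqrtr1. Qed.

Lemma dotp_sqr_le x y : dotp x y ^+ 2 <= dotp x x * dotp y y.
Proof.
have [->|y0] := eqVneq y 0; first by rewrite dotpC dotp0l expr0n mulr_ge0// dotp_ge0.
have yy : 0 < dotp y y by rewrite lt_def dotp_eq0 y0 dotp_ge0.
have := dotp_ge0 (dotp y y *: x + (- dotp x y) *: y).
rewrite !(dotpDl, dotpDr, dotpZl, dotpZr) (dotpC y x).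
set p := dotp x y; set q := dotp y y in yy *; set r := dotp x x => H.
rewrite -(ler_pM2l yy); nra.
Qed.

Lemma dotp_le x y : dotp x y <= enorm x * enorm y.
Proof.
apply: (le_trans (ler_norm _)).
rewrite -ler_sqr ?nnegrE ?mulr_ge0 ?enorm_ge0//.
by rewrite real_normK ?num_real// exprMn !enormK dotp_sqr_le.
Qed.

Lemma normr_dotp_le x y : `|dotp x y| <= enorm x * enorm y.
Proof.
rewrite ler_norml dotp_le andbT lerNl -mulN1r -dotpZl.
by rewrite (le_trans (dotp_le _ _))// enormZ normrN1 mul1r.
Qed.

Lemma enormD x y : enorm (x + y) <= enorm x + enorm y.
Proof.
rewrite -ler_sqr ?nnegrE ?addr_ge0 ?enorm_ge0//.
rewrite sqrrD !enormK !(dotpDl, dotpDr) (dotpC y x).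
by have := dotp_le x y; lra.
Qed.

Lemma enorm_sum m (F : 'I_m -> 'rV[R]_n) :
  enorm (\sum_(i < m) F i) <= \sum_(i < m) enorm (F i).
Proof.
apply: (big_ind2 (fun u c => enorm u <= c)) => //= [|u c v d uc vd].
  by rewrite enorm0.
by rewrite (le_trans (enormD _ _))// lerD.
Qed.

Lemma spectral_norm_le (A : 'M[R]_n) K :
  (forall u, enorm (u *m A) <= K * enorm u) -> 0 <= K -> spectral_norm A <= K.
Proof.
move=> AK K0; apply: ge_sup => [|_ [x x1 <-]].
  by exists (enorm (0 *m A)), 0 => //=; rewrite enorm0.
by rewrite (le_trans (AK x))// ler_piMr.
Qed.

(** An eigenvector shows that every real eigenvalue is at most the operator
    bound; a matrix without real eigenvalue has [lambda_max] equal to 0. *)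
Lemma lambda_max_le (A : 'M[R]_n) K :
  (forall u, enorm (u *m A) <= K * enorm u) -> 0 <= K -> lambda_max A <= K.
Proof.
move=> AK K0; rewrite /lambda_max.
have [->|/set0P ne] := eqVneq [set r : R | eigenvalue A r] set0; first by rewrite sup0.
apply: ge_sup => // r /= /eigenvalueP[u uA u0].
have u_gt0 : 0 < enorm u by rewrite lt_def enorm_eq0 u0 enorm_ge0.
have := AK u; rewrite uA enormZ ler_pM2r//.
by apply: le_trans; exact: ler_norm.
Qed.

Lemma dotp_continuous x : continuous (dotp x).
Proof.
apply: continuous_big => [|i _ y]; first exact: add_continuous.
by apply: continuousM; [exact: cst_continuous|exact: coord_continuous].
Qed.

Lemma enorm_continuous : continuous (@enorm R n).
Proof.
move=> y; apply: (@continuous_comp _ _ _ (fun x => dotp x x) Num.sqrt).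
  apply: continuous_big => [|i _ z]; first exact: add_continuous.
  by apply: continuousM; exact: coord_continuous.
exact: sqrt_continuous.
Qed.

Lemma dotp_differentiable x y : differentiable (dotp x) y.
Proof.
have -> : dotp x = \sum_(i < n) (fun z : 'rV[R]_n => x 0 i *: z 0 i).
  by apply/funext => z; rewrite fct_sumE.
apply: differentiable_sum => i.
by apply: differentiableZ; exact: differentiable_coord.
Qed.

End EuclideanTheory.

(** * Convex functions of one variable with bounded second differences *)

Section ConvexQuadraticBound.
Context {R : realType}.
Variables (F : R -> R) (C : R).
Hypothesis F_convex : forall x y l : R, 0 <= l -> l <= 1 ->
  F (l * x + (1 - l) * y) <= l * F x + (1 - l) * F y.
Hypothesis F_second_diff : forall t d : R,
  F (t + d) + F (t - d) <= 2 * F t + C * d ^+ 2.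

Lemma convex_slope_le (x t y : R) : x < t -> t < y ->
  (F t - F x) / (t - x) <= (F y - F t) / (y - t).
Proof.
move=> xt ty.
have tx0 : 0 < t - x by rewrite subr_gt0.
have yt0 : 0 < y - t by rewrite subr_gt0.
have yx0 : 0 < y - x by lra.
rewrite ler_pdivrMr// mulrAC ler_pdivlMr//.
have l0 : 0 <= (y - t) / (y - x) by rewrite divr_ge0// ltW.
have l1 : (y - t) / (y - x) <= 1 by rewrite ler_pdivrMr// mul1r; lra.
have := F_convex x y l0 l1.
have -> : (y - t) / (y - x) * x + (1 - (y - t) / (y - x)) * y = t.
  by field; rewrite gt_eqF.
rewrite -(ler_pM2r yx0) => H.
have E : ((y - t) / (y - x) * F x + (1 - (y - t) / (y - x)) * F y) * (y - x) =
  (y - t) * F x + (t - x) * F y by field; rewrite gt_eqF.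
by rewrite E in H; nra.
Qed.

(** The supremum of the slopes to the left of [t] is a subgradient: it lies below
    every slope to the right. *)
Lemma convex_subgradient (t : R) : exists s : R, forall d : R, F t + s * d <= F (t + d).
Proof.
pose S := [set (F t - F x) / (t - x) | x in [set x | x < t]].
have ubS (y : R) : t < y -> ubound S ((F y - F t) / (y - t)).
  by move=> ty _ [x /= xt <-]; exact: convex_slope_le.
have S0 : S !=set0.
  by exists ((F t - F (t - 1)) / (t - (t - 1))); exists (t - 1) => //=; lra.
exists (sup S) => d; have [d0|d0|->] := ltgtP d 0; last by rewrite mulr0 !addr0.
- have : (F t - F (t + d)) / (t - (t + d)) <= sup S.
    apply: ub_le_sup; last by exists (t + d) => //=; lra.
    by exists ((F (t + 1) - F t) / (t + 1 - t)); apply: ubS; lra.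
  by rewrite ler_pdivrMr; [nra|lra].
- have : sup S <= (F (t + d) - F t) / (t + d - t).
    by apply: ge_sup => //; apply: ubS; lra.
  by rewrite ler_pdivlMr; [nra|lra].
Qed.

(** The graph lies between a supporting line and the same line plus [C * d ^+ 2]:
    the upper bound is the second-difference bound combined with the supporting
    line evaluated at [t - d].  This pinches the difference quotients, and comparing the
    two lines at [s] and [t] makes the derivative nondecreasing and
    Lipschitz. *)
Lemma convex_C11 : exists G : R -> R,
  [/\ forall t : R, is_derive t 1 F (G t),
      forall t d : R, F t + G t * d <= F (t + d) &
      forall s t : R, s <= t -> 0 <= G t - G s <= 2 * C * (t - s)].
Proof.
have [G GF] := choice convex_subgradient.
have FG (t d : R) : F (t + d) <= F t + G t * d + C * d ^+ 2.
  by have := F_second_diff t d; have := GF t (- d); lra.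
have C0 : 0 <= C by have := FG 0 1; have := GF 0 1; rewrite expr1n; lra.
exists G; split => // [t|s t st].
- have FtG : (fun h : R => h^-1 *: (F (h *: 1 + t) - F t)) h @[h --> 0^'] --> G t.
    apply/cvgrPdist_le => e e0; near=> h.
    have h0 : h != 0 by near: h; exact: nbhs_dnbhs_neq.
    have -> : G t - h^-1 *: (F (h *: 1 + t) - F t) =
        h^-1 * (G t * h - (F (t + h) - F t)).
      by rewrite /GRing.scale /= mulr1 (addrC h); field.
    rewrite normrM normfV ler_pdivrMl ?normr_gt0//.
    have := FG t h; have := GF t h => H1 H2.
    rewrite ler0_norm; last by lra.
    apply: (@le_trans _ _ (C * h ^+ 2)); first by lra.
    rewrite -(real_normK (num_real h)) expr2 mulrA mulrC ler_wpM2l//.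
    have : `|h| <= e / (C + 1) by near: h; apply: dnbhs0_le; rewrite divr_gt0//; lra.
    rewrite ler_pdivlMr; last by lra.
    by have := normr_ge0 h; nra.
  split; first by apply/cvg_ex; exists (G t).
  exact/cvg_lim.
- have [->|st'] := eqVneq s t; first by rewrite !subrr mulr0 lexx.
  have ts0 : 0 < t - s by rewrite subr_gt0 lt_neqAle st'.
  have := GF s (t - s); have := GF t (s - t); have := FG s (t - s); have := FG t (s - t).
  rewrite !subrKC => H1 H2 H3 H4.
  apply/andP; split; first by rewrite -(ler_pM2r ts0); nra.
  by rewrite -(ler_pM2r ts0); nra.
Unshelve. all: by end_near. Qed.

End ConvexQuadraticBound.

(** * Conjugate of the scalar kernel *)

Lemma strongly_convex_midpoint (R : realType) n (phi : 'rV[R]_n -> \bar R)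
    (mu : R) x y a b :
  econvex (fun x => phi x - (mu / 2 * enorm x ^+ 2)%:E)%E ->
  phi x = a%:E -> phi y = b%:E ->
  (phi (2^-1 *: (x + y)) <= ((a + b) / 2 - mu / 8 * enorm (x - y) ^+ 2)%:E)%E.
Proof.
move=> cvx phix phiy; have /= := cvx x y 2^-1.
have -> : 1 - 2^-1 = 2^-1 :> R by field.
rewrite phix phiy -scalerDr => /(_ _ _)/wrap[].
  by rewrite invr_gt0.
  by rewrite invf_lt1// ltr1n.
rewrite -!EFinM -!EFinD; case: (phi _) => [c| |] //; last by move=> _; rewrite leNye.
rewrite -EFinD !lee_fin => /le_trans H.
have {H} := H _ (lexx _); rewrite lerBlDr => /le_trans; apply.
rewrite !enormK -(scaleN1r y) !(dotpDl, dotpDr, dotpZl, dotpZr) (dotpC y x).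
by rewrite le_eqVlt; apply/orP; left; apply/eqP; field.
Qed.

(** The midpoint inequality is the only form in which the strong convexity of
    [phi] reaches its kernel: it is the inequality for two points of a line
    through the origin, whose signed coordinates are [s1] and [s2]. *)
Section RadialConjugate.
Context {R : realType}.
Variables (h : R -> \bar R) (mu : R).
Hypothesis mu_gt0 : 0 < mu.
Hypothesis h_ge0 : forall t, (0 <= h t)%E.
Hypothesis h0 : h 0 = 0%E.
Hypothesis h_midpoint : forall s1 s2 a b : R,
  h `|s1| = a%:E -> h `|s2| = b%:E ->
  (h `|(s1 + s2) / 2|%R <= ((a + b) / 2 - mu / 8 * (s1 - s2) ^+ 2)%:E)%E.

Let hs (y : R) : R := fine (conjugate *%R h y).

(** The midpoint inequality between [s] and [- s], whose midpoint value is
    [h 0 = 0]. *)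
Lemma kernel_lower (s : R) : 0 <= s -> ((mu / 2 * s ^+ 2)%:E <= h s)%E.
Proof.
move=> s0; have := h_ge0 s; case E : (h s) => [a| |] // _; last by rewrite leey.
have Es : h `|s| = a%:E by rewrite ger0_norm.
have ENs : h `|- s| = a%:E by rewrite normrN.
have := h_midpoint Es ENs.
by rewrite subrr mul0r normr0 h0 !lee_fin opprK; lra.
Qed.

Lemma conjugate_kernel_fin (y : R) : 0 <= y -> conjugate *%R h y \is a fin_num.
Proof.
move=> y0; rewrite fin_real//; apply/andP; split.
  apply: (@lt_le_trans _ _ 0%E) => //; apply: ereal_sup_ubound.
  by exists 0 => //; rewrite mul0r h0 subee.
apply: (@le_lt_trans _ _ (y ^+ 2 / (2 * mu))%:E); last exact: ltry.
apply: ge_ereal_sup => _ [s _ <-].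
have bnd : 0 <= y ^+ 2 / (2 * mu) by rewrite divr_ge0 ?sqr_ge0// mulr_ge0// ltW.
have := h_ge0 s; case hsa : (h s) => [a| |]//; last by move=> _; exact: leNye.
rewrite -EFinB !lee_fin => a0.
have [s0|s0] := leP 0 s; last by nra.
have := kernel_lower s0; rewrite hsa lee_fin => sa.
rewrite ler_pdivlMr ?mulr_gt0//.
by have := ler_wpM2l (ltW mu_gt0) sa; have := sqr_ge0 (mu * s - y); nra.
Qed.

(** The even function [fun t => hs `|t|] is the conjugate of [fun s => h `|s|];
    the next two lemmas say so without extended reals. *)
Lemma conjugate_kernel_ge (s t a : R) : h `|s| = a%:E -> s * t - a <= hs `|t|.
Proof.
move=> hsa; apply: (@le_trans _ _ (`|s| * `|t| - a)).
  by rewrite lerD2r -normrM ler_norm.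
rewrite -lee_fin /hs fineK ?conjugate_kernel_fin//.
by apply: ereal_sup_ubound; exists `|s| => //; rewrite hsa.
Qed.

Lemma conjugate_kernel_approx (t e : R) : 0 < e ->
  exists s a, h `|s| = a%:E /\ hs `|t| - e < s * t - a.
Proof.
move=> e0; have fin := conjugate_kernel_fin (normr_ge0 t).
have [_ [s _ <-]] := ub_ereal_sup_adherent e0 fin.
rewrite -/(conjugate _ _ _) -(fineK fin) -/(hs _) -EFinB => lt_s.
have := h_ge0 s; case hsa : (h s) lt_s => [a| |]//; rewrite -EFinB !lte_fin lee_fin => lt_s a0.
have [s0|s0] := leP 0 s.
  have [t0|t0] := leP 0 t.
    by exists s, a; rewrite ger0_norm// hsa; split => //; rewrite -[t in s * t]ger0_norm.
  exists (- s), a; rewrite normrN ger0_norm// hsa; split => //.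
  by rewrite mulNr -mulrN -[- t]ltr0_norm.
exists 0, 0; rewrite normr0 h0; split => //; rewrite mul0r subr0 (lt_le_trans lt_s)//.
by have := normr_ge0 t; nra.
Qed.

(** Strong convexity of a function and smoothness of its conjugate are dual:
    adding near-maximizers [s1] of the conjugate at [t + d] and [s2] at [t - d]
    and comparing with their midpoint at [t] leaves
    [(s1 - s2) * d - mu / 4 * (s1 - s2) ^+ 2], which is at most
    [mu^-1 * d ^+ 2]. *)
Lemma conjugate_kernel_C11 : exists G : R -> R,
  [/\ forall t : R, is_derive t 1 (fun t => hs `|t|) (G t),
      G 0 = 0,
      forall d : R, 0 <= hs `|d| - hs 0 <= mu^-1 * d ^+ 2 &
      forall s t : R, s <= t -> 0 <= G t - G s <= 2 * mu^-1 * (t - s)].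
Proof.
have cvx (x y l : R) : 0 <= l -> l <= 1 ->
    hs `|l * x + (1 - l) * y| <= l * hs `|x| + (1 - l) * hs `|y|.
  move=> l0 l1; apply/ler_addgt0Pr => e e0.
  have [s [a [sa]]] := conjugate_kernel_approx (l * x + (1 - l) * y) e0.
  by have := conjugate_kernel_ge x sa; have := conjugate_kernel_ge y sa; nra.
have smooth (t d : R) : hs `|t + d| + hs `|t - d| <= 2 * hs `|t| + mu^-1 * d ^+ 2.
  apply/ler_addgt0Pr => e e0; have e20 : 0 < e / 2 by lra.
  have [s1 [a1 [sa1 H1]]] := conjugate_kernel_approx (t + d) e20.
  have [s2 [a2 [sa2 H2]]] := conjugate_kernel_approx (t - d) e20.
  have := h_midpoint sa1 sa2; have := h_ge0 `|(s1 + s2) / 2|.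
  case E : (h _) => [c| |]//; rewrite !lee_fin => c0 Hc.
  have H3 := conjugate_kernel_ge t E.
  have : (s1 - s2) * d <= mu / 4 * (s1 - s2) ^+ 2 + mu^-1 * d ^+ 2.
    have muV0 : 0 <= mu^-1 by rewrite invr_ge0 ltW.
    have := mulr_ge0 muV0 (sqr_ge0 (mu / 2 * (s1 - s2) - d)).
    have -> : mu^-1 * (mu / 2 * (s1 - s2) - d) ^+ 2 =
      mu / 4 * (s1 - s2) ^+ 2 - (s1 - s2) * d + mu^-1 * d ^+ 2.
      by field; rewrite gt_eqF.
    by lra.
  by nra.
have [G [dG GF GL]] := convex_C11 cvx smooth.
have G0 : G 0 = 0.
  (* evenness makes G 0 * d quadratically small in d; d := mu * G 0 is the
     scale at which this forces G 0 = 0 *)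
  have := GF 0 (mu * G 0); have := smooth 0 (mu * G 0).
  have -> : mu^-1 * (mu * G 0) ^+ 2 = mu * G 0 ^+ 2 by field; rewrite gt_eqF.
  rewrite !add0r normrN normr0 => H1 H2.
  apply/eqP; rewrite -sqrf_eq0 eq_le sqr_ge0 andbT -(pmulr_rle0 _ mu_gt0).
  nra.
exists G; split => // d.
have := GF 0 d; rewrite G0 normr0 add0r; have := smooth 0 d.
have := GF 0 (- d); rewrite G0 normr0 !add0r normrN; lra.
Qed.

End RadialConjugate.

(** * Derivatives along lines *)

Section LineDerivative.
Context {R : realType} {n : nat}.
Implicit Types (f : 'rV[R]_n -> R) (x u v : 'rV[R]_n).

Let growth_line f x u :
  (fun h : R => h^-1 *: ((f \o shift x) (h *: u) - f x)) =
  (fun h : R => h^-1 *: (((fun t : R => f (x + t *: u)) \o shift 0) (h *: 1) -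
                         f (x + 0 *: u))).
Proof.
by apply/funext => t /=; rewrite scale0r !addr0 (addrC x) [t%:A]mulr1.
Qed.

Lemma derive_line f x u : 'D_u f x = derive1 (fun t : R => f (x + t *: u)) 0.
Proof. by rewrite derive1E /derive growth_line. Qed.

Lemma derivable_line f x u :
  derivable f x u <-> derivable (fun t : R => f (x + t *: u)) 0 1.
Proof. by rewrite /derivable growth_line. Qed.

Lemma enorm_line x u (t : R) :
  enorm (x + t *: u) =
  Num.sqrt (dotp x x + (2 * dotp x u) * t + dotp u u * t ^+ 2).
Proof.
rewrite /enorm !(dotpDl, dotpDr, dotpZl, dotpZr) (dotpC u x).
by congr Num.sqrt; ring.
Qed.

Lemma is_derive_enorm_line x u : x != 0 ->
  is_derive (0 : R) 1 (fun t => enorm (x + t *: u)) (dotp x u / enorm x).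
Proof.
move=> x0; under eq_fun do rewrite enorm_line.
have xx0 : 0 < dotp x x by rewrite lt_def dotp_eq0 x0 dotp_ge0.
pose P (t : R) : R := dotp x x + (2 * dotp x u) * t + dotp u u * t ^+ 2.
have dP : is_derive (0 : R) 1 P (2 * dotp x u).
  apply: is_derive_eq; rewrite /GRing.scale /=; ring.
have P0 : P 0 = dotp x x by rewrite /P; ring.
have ds : is_derive (P 0) 1 Num.sqrt (2 * Num.sqrt (P 0))^-1.
  by apply: is_derive1_sqrt; rewrite P0.
have := is_derive1_comp ds dP; rewrite P0 -/(enorm x) => dc.
have -> : dotp x u / enorm x = (2 * enorm x)^-1 * (2 * dotp x u).
  by field; rewrite enorm_eq0.
exact: dc.
Qed.

Lemma is_derive_comp_enorm_line (k : R -> R) x u (c : R) : x != 0 ->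
  is_derive (enorm x) 1 k c ->
  is_derive (0 : R) 1 (fun t => k (enorm (x + t *: u))) (c * (dotp x u / enorm x)).
Proof.
move=> x0 dk; pose N (t : R) := enorm (x + t *: u).
have N0 : N 0 = enorm x by rewrite /N scale0r addr0.
have dk' : is_derive (N 0) 1 k c by rewrite N0.
exact: (is_derive1_comp dk' (is_derive_enorm_line u x0)).
Qed.

End LineDerivative.

Lemma mulmx_jacobian_line (R : realType) n (G : 'rV[R]_n -> 'rV[R]_n) x u i :
  differentiable G x ->
  (u *m jacobian G x) 0 i = derive1 (fun t : R => G (x + t *: u) 0 i) 0.
Proof.
move=> dG; rewrite -deriveEjacobian// derive_mx ?mxE; last exact: diff_derivable.
exact: derive_line.
Qed.

(** Without a differential, the choice operator behind the Jacobian returns the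
    null map. *)
Lemma jacobian_default (R : realType) n (G : 'rV[R]_n -> 'rV[R]_n) x :
  ~ differentiable G x -> jacobian G x = 0.
Proof.
move=> nd; rewrite /jacobian /diff.
set P := fun df : {linear 'rV[R]_n -> 'rV[R]_n} => _.
have [exP|nexP] := pselect (exists df, P df).
  by exfalso; apply: nd; apply/diffP; exact: getPex exP.
rewrite /get /xget; case: pselect => [exP|_].
  by exfalso; case: exP => df /asboolP Pdf; apply: nexP; exists df.
by apply/matrixP => i j; rewrite !mxE.
Qed.

(** * Radial functions: conjugate, gradient and Hessian *)

(** Cauchy-Schwarz gives one inequality; for the other a nonnegative [s] is the
    norm of a point of the ray spanned by [v]. *)
Lemma conj_fun_radial (R : realType) n (phi : 'rV[R]_n -> \bar R) (h : R -> \bar R) v :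
  'I_n -> (forall t, (0 <= h t)%E) -> h 0 = 0%E -> (forall x, phi x = h (enorm x)) ->
  conj_fun phi v = fine (conjugate *%R h (enorm v)).
Proof.
move=> i h_ge0 h0 phih; congr fine; apply/eqP; rewrite eq_le; apply/andP; split.
  apply: ge_ereal_sup => _ [x _ <-]; rewrite phih.
  apply: (@le_trans _ _ ((enorm x * enorm v)%:E - h (enorm x))%E).
    by rewrite leeD2r// lee_fin dotp_le.
  by apply: ereal_sup_ubound; exists (enorm x).
apply: ge_ereal_sup => _ [s _ <-].
have [s0|s0] := leP 0 s; last first.
  (* negative arguments of h do no better than s = 0 *)
  apply: (@le_trans _ _ (0 : \bar R)%E); last first.
    apply: ereal_sup_ubound; exists 0 => //.
    by rewrite dotp0l phih enorm0 h0 subee.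
  have := h_ge0 s; case: (h s) => [a| |]//.
  by rewrite -EFinB !lee_fin => a0; have := enorm_ge0 v; nra.
have [w w1 wv] : exists2 w : 'rV[R]_n, enorm w = 1 & dotp w v = enorm v.
  have [->|v0] := eqVneq v 0.
    by exists (delta_mx 0 i); [exact: enorm_delta|rewrite dotpC dotp0l enorm0].
  have nv0 : enorm v != 0 by rewrite enorm_eq0.
  exists ((enorm v)^-1 *: v).
    by rewrite enormZ ger0_norm ?mulVf// invr_ge0 enorm_ge0.
  by rewrite dotpZl -enormK expr2 mulKf.
apply: ereal_sup_ubound; exists (s *: w) => //.
by rewrite dotpZl wv phih enormZ w1 mulr1 ger0_norm.
Qed.

(** The quadratic control of [k] at 0 replaces differentiability of the norm at
    the origin. *)
Section RadialFunction.
Context {R : realType} {n : nat}.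
Variables (g : 'rV[R]_n -> R) (k : R -> R) (C : R).
Hypothesis g_radial : forall x, g x = k (enorm x).
Hypothesis k_derivable : forall r : R, 0 < r -> derivable k r 1.
Hypothesis k_quadratic : forall r : R, 0 <= r -> 0 <= k r - k 0 <= C * r ^+ 2.

Lemma grad_radial x : grad g x = (derive1 k (enorm x) / enorm x) *: x.
Proof.
apply/rowP => i; rewrite !mxE derive_line derive1E.
have -> : (fun t => g (x + t *: delta_mx 0 i)) =
    (fun t : R => k (enorm (x + t *: delta_mx 0 i))) by apply/funext => t.
have [->|x0] := eqVneq x 0.
  rewrite mxE mulr0; apply: derive_val.
  have -> : (fun t => k (enorm (0 + t *: delta_mx 0 i : 'rV[R]_n))) = (fun t : R => k `|t|).
    by apply/funext => t; rewrite add0r enormZ enorm_delta mulr1.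
  have : (fun h : R => h^-1 *: (k `|(h *: 1 + 0 : R)| - k `|(0 : R)|)) h
      @[h --> 0^'] --> (0 : R).
    apply/cvgrPdist_le => e e0; near=> h.
    have h0 : h != 0 by near: h; exact: nbhs_dnbhs_neq.
    rewrite sub0r normrN normrM normfV ler_pdivrMl ?normr_gt0//.
    rewrite addr0 normr0 [h *: 1]mulr1.
    have /andP[k0 k1] := k_quadratic (normr_ge0 h).
    rewrite ger0_norm// (le_trans k1)// expr2 mulrA [leLHS]mulrC ler_wpM2l//.
    have : `|h| <= e / (`|C| + 1) by near: h; apply: dnbhs0_le; rewrite divr_gt0// ltr_wpDl.
    rewrite ler_pdivlMr ?ltr_wpDl// => H.
    by have := ler_norm C; have := normr_ge0 h; nra.
  by move=> cv; split; [apply/cvg_ex; exists 0|exact/cvg_lim].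
apply: derive_val.
have r0 : 0 < enorm x by rewrite lt_def enorm_eq0 x0 enorm_ge0.
have dk : is_derive (enorm x) 1 k (derive1 k (enorm x)).
  by rewrite derive1E; apply: derivableP; exact: k_derivable.
have := is_derive_comp_enorm_line (delta_mx 0 i) x0 dk.
by rewrite dotp_delta mulrA mulrAC.
Unshelve. all: by end_near. Qed.

Let p := derive1 k.

(** Along the ray through [x] the gradient is [p s] times the unit vector, so
    differentiability of the gradient forces that of [p]. *)
Lemma derive1_radial_derivable x : x != 0 -> differentiable (grad g) x ->
  derivable p (enorm x) 1.
Proof.
move=> x0 dG; set r := enorm x.
have r0 : 0 < r by rewrite lt_def enorm_eq0 x0 enorm_ge0.
pose w := r^-1 *: x.
have rw : r *: w = x by rewrite scalerA divff ?scale1r// gt_eqF.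
have w1 : dotp w w = 1.
  by rewrite dotpZl dotpZr -enormK -/r; field; rewrite gt_eqF.
have nw1 : enorm w = 1 by rewrite /enorm w1 sqrtr1.
have pE : \forall s \near r, dotp w (grad g (s *: w)) = p s.
  near=> s; have s0 : 0 < s by near: s; exact: lt_nbhsr.
  rewrite grad_radial enormZ nw1 mulr1 gtr0_norm// scalerA divfK ?gt_eqF//.
  by rewrite dotpZr w1 mulr1.
apply: (near_eq_derivable pE).
apply/derivable1_diffP.
apply: (@differentiable_comp _ _ _ _ (fun s : R => grad g (s *: w)) (dotp w));
  last exact: dotp_differentiable.
apply: (@differentiable_comp _ _ _ _ (fun s : R => s *: w) (grad g)).
  by apply: differentiableZl.
by rewrite rw.
Unshelve. all: by end_near. Qed.

(** The two terms combine to multiplication by [p' r] on the radial direction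
    and by [p r / r] on the orthogonal ones.  Along the line through [x] directed
    by [u], the gradient is the scalar function [p s / s] of the norm times an
    affine function, and the product rule applies. *)
Lemma hess_radial x u : x != 0 -> differentiable (grad g) x ->
  let r := enorm x in
  u *m hess g x = ((derive1 p r - p r / r) / r ^+ 2 * dotp x u) *: x + (p r / r) *: u.
Proof.
move=> x0 dG r; have r0 : 0 < r by rewrite lt_def enorm_eq0 x0 enorm_ge0.
have rn0 : r != 0 by rewrite gt_eqF.
have dp := derive1_radial_derivable x0 dG.
apply/rowP => i; rewrite mulmx_jacobian_line// derive1E; apply: derive_val.
have -> : (fun t : R => grad g (x + t *: u) 0 i) =
   (fun t : R => p (enorm (x + t *: u)) / enorm (x + t *: u)) *
   (fun t : R => x 0 i + t * u 0 i).
  by apply/funext => t; rewrite grad_radial !mxE.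
have dV : is_derive r 1 (fun s : R => s^-1) (- r ^- 2).
  split; first exact: derivableV.
  by rewrite deriveV// derive_id [_ *: _]mulr1.
have dp_r : is_derive r 1 p (derive1 p r) by rewrite derive1E; exact: derivableP.
have dq_r : is_derive r 1 (fun s => p s / s) (p r * - r ^- 2 + r^-1 * derive1 p r).
  exact: is_deriveM dp_r dV.
have dq_line := is_derive_comp_enorm_line u x0 dq_r.
have dx : is_derive (0 : R) 1 (fun t => x 0 i + t * u 0 i) (u 0 i).
  by apply: is_derive_eq; rewrite /GRing.scale /=; ring.
have dG_line := is_deriveM dq_line dx; apply: (is_derive_eq dG_line).
rewrite scale0r addr0 !mxE -/r /GRing.scale /=; field.
by rewrite -/r.
Qed.

(** By the preceding formula and Pythagoras off the origin.  At the origin the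
    Jacobian is a limit of the quotients [(p s / s) *: u], so that a bound of
    [p s / s] passes to it; this is why [x = 0] has a condition of its own. *)
Lemma hess_radial_le x u M : 0 <= M ->
  (x = 0 -> forall s, 0 < s -> `|p s / s| <= M) ->
  (x != 0 -> `|p (enorm x) / enorm x| <= M) ->
  (x != 0 -> derivable p (enorm x) 1 -> `|derive1 p (enorm x)| <= M) ->
  enorm (u *m hess g x) <= M * enorm u.
Proof.
move=> M0 Mq0 Mq Mc.
have [dG|ndG] := pselect (differentiable (grad g) x); last first.
  by rewrite /hess jacobian_default// mulmx0 enorm0 mulr_ge0// enorm_ge0.
have [x0|x0] := eqVneq x 0; last first.
  rewrite hess_radial//; set r := enorm x; set q := p r / r; set c := derive1 p r.
  have r0 : 0 < r by rewrite lt_def enorm_eq0 x0 enorm_ge0.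
  have hq : `|q| <= M by exact: Mq.
  have hc : `|c| <= M by apply: Mc => //; exact: derive1_radial_derivable.
  rewrite -ler_sqr ?nnegrE ?mulr_ge0 ?enorm_ge0// exprMn !enormK.
  rewrite !(dotpDl, dotpDr, dotpZl, dotpZr) (dotpC u x) -(enormK x) -/r.
  have := dotp_sqr_le x u; rewrite -(enormK x) -/r.
  set b := dotp x u; set U := dotp u u => bU.
  (* A is the squared length of the radial component of u *)
  pose A := b ^+ 2 / r ^+ 2.
  have A0 : 0 <= A by rewrite divr_ge0// sqr_ge0.
  have AU : A <= U by rewrite ler_pdivrMr ?exprn_gt0// mulrC.
  rewrite [leLHS](_ : _ = c ^+ 2 * A + q ^+ 2 * (U - A)); last first.
    by rewrite /A; field; rewrite gt_eqF.
  have c2 : c ^+ 2 <= M ^+ 2 by rewrite -(real_normK (num_real c)) ler_sqr ?nnegrE.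
  have q2 : q ^+ 2 <= M ^+ 2 by rewrite -(real_normK (num_real q)) ler_sqr ?nnegrE.
  nra.
have [->|u0] := eqVneq u 0; first by rewrite mul0mx enorm0 mulr0.
rewrite x0 in dG *; rewrite /hess -deriveEjacobian//.
have cv : (fun h : R => enorm (h^-1 *: ((grad g \o shift 0) (h *: u) - grad g 0))) h
    @[h --> 0^'] --> enorm ('D_u (grad g) 0).
  apply: (continuous_cvg _ (@enorm_continuous R n _)).
  exact: diff_derivable.
rewrite -(cvg_lim _ cv)//; apply: limr_le; first by apply/cvg_ex; eexists; exact: cv.
have nu_gt0 : 0 < enorm u by rewrite lt_def enorm_eq0 u0 enorm_ge0.
near=> h; have h0 : h != 0 by near: h; exact: nbhs_dnbhs_neq.
rewrite /= addr0 !grad_radial scaler0 subr0 scalerA scalerA [leLHS]enormZ ler_pM2r//.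
rewrite mulrAC mulVf// mul1r.
by apply: Mq0 => //; rewrite enormZ mulr_gt0 ?normr_gt0.
Unshelve. all: by end_near. Qed.

End RadialFunction.

(** * Sums of ridge functions *)

(** All derivatives of [psi (dotp b x)] reduce to those of the scalar function
    [psi]. *)
Section RidgeSum.
Context {R : realType} {n m : nat}.
Variables (a : 'I_m -> 'rV[R]_n) (psi dpsi ddpsi : 'I_m -> R -> R).
Hypothesis dpsiP : forall i (t : R), is_derive t 1 (psi i) (dpsi i t).
Hypothesis ddpsiP : forall i (t : R), is_derive t 1 (dpsi i) (ddpsi i t).
Hypothesis ddpsi_cont : forall i, continuous (ddpsi i).

Let f (x : 'rV[R]_n) : R := \sum_(i < m) psi i (dotp (a i) x).

Let is_derive_ridge_line (k dk : R -> R) (b x u : 'rV[R]_n) :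
  (forall t : R, is_derive t 1 k (dk t)) ->
  is_derive (0 : R) 1 (fun t => k (dotp b (x + t *: u))) (dk (dotp b x) * dotp b u).
Proof.
move=> kP; pose l (t : R) := dotp b x + t * dotp b u.
have -> : (fun t => k (dotp b (x + t *: u))) = k \o l.
  by apply/funext => t /=; rewrite dotpDr dotpZr.
have l0 : l 0 = dotp b x by rewrite /l mul0r addr0.
have dl : is_derive (0 : R) 1 l (dotp b u).
  by apply: is_derive_eq; rewrite /GRing.scale /=; ring.
by rewrite -l0; exact: is_derive1_comp.
Qed.

Let ridge_differentiable (k dk : R -> R) (b x : 'rV[R]_n) :
  (forall t : R, is_derive t 1 k (dk t)) -> differentiable (k \o dotp b) x.
Proof.
move=> kP; apply: differentiable_comp; first exact: dotp_differentiable.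
by apply/derivable1_diffP; case: (kP (dotp b x)).
Qed.

Lemma ridge_sum_differentiable x : differentiable f x.
Proof.
have -> : f = \sum_(i < m) (psi i \o dotp (a i)).
  by apply/funext => z; rewrite fct_sumE.
by apply: differentiable_sum => i; exact: ridge_differentiable.
Qed.

Lemma grad_ridge_sum x : grad f x = \sum_(i < m) dpsi i (dotp (a i) x) *: a i.
Proof.
apply/rowP => j; rewrite mxE summxE derive_line derive1E; apply: derive_val.
have -> : (fun t => f (x + t *: delta_mx 0 j)) =
   \sum_(i < m) (fun t : R => psi i (dotp (a i) (x + t *: delta_mx 0 j))).
  by apply/funext => t; rewrite fct_sumE.
under [X in is_derive _ _ _ X]eq_bigr do rewrite mxE -dotp_delta.
by apply: is_derive_sum => i; exact: is_derive_ridge_line.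
Qed.

Lemma grad_ridge_sum_differentiable x : differentiable (grad f) x.
Proof.
have -> : grad f = \sum_(i < m) (fun z => (dpsi i \o dotp (a i)) z *: a i).
  by apply/funext => z; rewrite fct_sumE grad_ridge_sum.
apply: differentiable_sum => i; apply: differentiableZl.
exact: ridge_differentiable.
Qed.

Lemma hess_ridge_sum x u :
  u *m hess f x = \sum_(i < m) (ddpsi i (dotp (a i) x) * dotp (a i) u) *: a i.
Proof.
apply/rowP => j; rewrite mulmx_jacobian_line; last exact: grad_ridge_sum_differentiable.
rewrite summxE derive1E; apply: derive_val.
have -> : (fun t : R => grad f (x + t *: u) 0 j) =
   \sum_(i < m) (fun t : R => a i 0 j *: dpsi i (dotp (a i) (x + t *: u))).
  apply/funext => t; rewrite fct_sumE grad_ridge_sum summxE.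
  by apply: eq_bigr => i _; rewrite mxE mulrC.
under [X in is_derive _ _ _ X]eq_bigr do rewrite mxE mulrC.
by apply: is_derive_sum => i; apply: is_deriveZ; exact: is_derive_ridge_line.
Qed.

Lemma hess_ridge_sum_continuous : continuous (hess f).
Proof.
have -> : hess f = fun x => \sum_(i < m) ddpsi i (dotp (a i) x) *: ((a i)^T *m a i).
  apply/funext => x; apply/row_matrixP => j; rewrite rowE hess_ridge_sum.
  rewrite linear_sum /=; apply: eq_bigr => i _.
  rewrite linearZ /= -scalerA; congr (_ *: _).
  by apply/rowP => l; rewrite !mxE big_ord1 !mxE dotp_delta.
apply: continuous_big => [|i _ x]; first exact: add_continuous.
apply: continuousZr_tmp.
by apply: (@continuous_comp _ _ _ (dotp (a i)) (ddpsi i));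
  [exact: dotp_continuous|exact: ddpsi_cont].
Qed.

Lemma ridge_sum_C2 : C2_on setT f.
Proof.
move=> x _; split; [exact: ridge_sum_differentiable|
  exact: grad_ridge_sum_differentiable|exact: hess_ridge_sum_continuous].
Qed.

End RidgeSum.

(** * The phase retrieval objective *)

Section PhaseRetrieval.
Context {R : realType} {n m : nat}.
Variables (a : 'I_m -> 'rV[R]_n) (y : 'I_m -> R).

Let f := phase_retrieval a y.
Let psi i (s : R) : R := 4^-1 * (y i ^+ 2 - s ^+ 2) ^+ 2.
Let dpsi i (s : R) : R := (s ^+ 2 - y i ^+ 2) * s.
Let ddpsi i (s : R) : R := 3 * s ^+ 2 - y i ^+ 2.

Let dpsiP i (t : R) : is_derive t 1 (psi i) (dpsi i t).
Proof.
by apply: is_derive_eq; rewrite /dpsi /GRing.scale /=; field.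
Qed.

Let ddpsiP i (t : R) : is_derive t 1 (dpsi i) (ddpsi i t).
Proof. by apply: is_derive_eq; rewrite /ddpsi /GRing.scale /=; ring. Qed.

Let ddpsi_cont i : continuous (ddpsi i).
Proof.
move=> t; apply: differentiable_continuous; apply/derivable1_diffP.
exact: ex_derive.
Qed.

Let fE : f = fun x => \sum_(i < m) psi i (dotp (a i) x).
Proof. by apply/funext => x; rewrite /f /phase_retrieval mulr_sumr. Qed.

Lemma phase_retrieval_C2 : C2_on setT f.
Proof. by rewrite fE; exact: (ridge_sum_C2 a dpsiP ddpsiP ddpsi_cont). Qed.

Lemma hess_phase_retrieval_le : exists A B : R, [/\ 0 <= A, 0 <= B &
  forall x u, enorm (u *m hess f x) <= (A * enorm x ^+ 2 + B) * enorm u].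
Proof.
exists (\sum_(i < m) 3 * enorm (a i) ^+ 4), (\sum_(i < m) y i ^+ 2 * enorm (a i) ^+ 2).
split=> [||x u].
- by apply: sumr_ge0 => i _; rewrite mulr_ge0 ?exprn_ge0 ?enorm_ge0.
- by apply: sumr_ge0 => i _; rewrite mulr_ge0 ?sqr_ge0.
rewrite fE (hess_ridge_sum a dpsiP ddpsiP) (le_trans (enorm_sum _))//.
rewrite mulr_suml -big_split mulr_suml; apply: ler_sum => i _ /=.
rewrite enormZ normrM; have := normr_dotp_le (a i) u; have := normr_dotp_le (a i) x.
set s := dotp (a i) x; set b := dotp (a i) u.
set N := enorm (a i); set X := enorm x; set U := enorm u => sNX bNU.
have N0 : 0 <= N by exact: enorm_ge0.
have dd_le : `|ddpsi i s| <= 3 * (N * X) ^+ 2 + y i ^+ 2.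
  have s2 : s ^+ 2 <= (N * X) ^+ 2.
    by rewrite -(real_normK (num_real s)) ler_sqr// nnegrE (le_trans _ sNX).
  by rewrite ler_norml /ddpsi; have := sqr_ge0 s; have := sqr_ge0 (y i); lra.
apply: (@le_trans _ _ ((3 * (N * X) ^+ 2 + y i ^+ 2) * (N * U) * N)).
  by rewrite ler_wpM2r// ler_pM.
by rewrite le_eqVlt; apply/orP; left; apply/eqP; ring.
Qed.

Hypothesis a_span : (<<codom a>> = fullv)%VS.

Let S (x : 'rV[R]_n) : R := \sum_(i < m) dotp (a i) x ^+ 2.

Let S_ge0 x : 0 <= S x.
Proof. by apply: sumr_ge0 => i _; rewrite sqr_ge0. Qed.

(** Every [v] is a combination of the [a i], so [dotp v] is the same combination
    of the measurements. *)
Lemma dotp_le_measurements v : exists2 k : R, 0 <= k &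
  forall x, `|dotp v x| <= k * Num.sqrt (S x).
Proof.
have : v \in <<in_tuple (codom a)>>%VS by rewrite a_span memvf.
move/coord_span => ->; set c := fun i => coord (in_tuple (codom a)) i v.
exists (\sum_i `|c i|) => [|x]; first exact: sumr_ge0.
rewrite dotp_suml (le_trans (ler_norm_sum _ _ _))// mulr_suml; apply: ler_sum => i _.
rewrite dotpZl normrM ler_wpM2l//.
have /codomP[j ->] : (in_tuple (codom a))`_i \in codom a by rewrite mem_nth.
rewrite -sqrtr_sqr ler_wsqrtr// /S (bigD1 j)//= lerDl.
by apply: sumr_ge0 => l _; rewrite sqr_ge0.
Qed.

Lemma measurements_ge : exists2 k : R, 0 < k & forall x, k * enorm x ^+ 2 <= S x.
Proof.
have [c c0 cP] : exists2 c : 'I_n -> R, forall j, 0 <= c j &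
    forall j x, `|dotp (delta_mx 0 j) x| <= c j * Num.sqrt (S x).
  have ex j := cid2 (dotp_le_measurements (delta_mx 0 j)).
  by exists (fun j => s2val (ex j)) => j; [exact: (s2valP (ex j))|exact: (s2valP' (ex j))].
have C0 : 0 < 1 + \sum_j c j ^+ 2.
  by rewrite ltr_pwDl// sumr_ge0// => j _; rewrite sqr_ge0.
exists (1 + \sum_j c j ^+ 2)^-1 => [|x]; first by rewrite invr_gt0.
rewrite ler_pdivrMl// mulrDl mul1r ler_wpDl// enormK mulr_suml; apply: ler_sum => j _.
have := cP j x; rewrite dotpC dotp_delta -expr2 -(real_normK (num_real (x 0 j))) => xj.
have := S_ge0 x => Sx0; rewrite -[S x]sqr_sqrtr// -exprMn.
by rewrite ler_sqr// nnegrE mulr_ge0// sqrtr_ge0.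
Qed.

(** Testing against [x] gives
    [dotp (grad f x) x = \sum_i (s ^+ 4 - y i ^+ 2 * s ^+ 2)], with
    [s = dotp (a i) x]: a quartic bounded below through [measurements_ge], minus
    a quadratic. *)
Lemma grad_phase_retrieval_ge : exists c D : R, [/\ 0 < c, 0 <= D &
  forall x, c * enorm x ^+ 3 - D * enorm x <= enorm (grad f x)].
Proof.
have [k k0 kS] := measurements_ge.
have M0 : 0 < m%:R + 1 :> R by rewrite ltr_wpDl.
set B := \sum_(i < m) y i ^+ 2 * enorm (a i) ^+ 2.
exists (k ^+ 2 / (m%:R + 1)), B; split=> [||x].
- by rewrite divr_gt0// exprn_gt0.
- by apply: sumr_ge0 => i _; rewrite mulr_ge0 ?sqr_ge0.
have [->|x0] := eqVneq x 0.
  by rewrite enorm0 expr0n !mulr0 subr0 enorm_ge0.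
set t := enorm x; have t0 : 0 < t by rewrite lt_def enorm_eq0 x0 enorm_ge0.
rewrite -(ler_pM2r t0); apply: le_trans (dotp_le _ _).
rewrite fE (grad_ridge_sum a dpsiP) dotp_suml.
(* s^4 is bounded below by the tangent of z |-> z^2 at z = l t^2, which reduces
   the quartic sum to S x; this choice of l keeps the m constant terms smaller
   than the gain *)
pose l := k / (m%:R + 1).
have term i : 2 * l * t ^+ 2 * dotp (a i) x ^+ 2 - l ^+ 2 * t ^+ 4 -
    y i ^+ 2 * enorm (a i) ^+ 2 * t ^+ 2 <=
    dotp (dpsi i (dotp (a i) x) *: a i) x.
  rewrite dotpZl /dpsi; have := normr_dotp_le (a i) x; rewrite -/t.
  set s := dotp (a i) x => sN.
  have s2 : s ^+ 2 <= enorm (a i) ^+ 2 * t ^+ 2.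
    by rewrite -exprMn -(real_normK (num_real s)) ler_sqr// nnegrE (le_trans _ sN).
  have := ler_wpM2l (sqr_ge0 (y i)) s2; have := sqr_ge0 (s ^+ 2 - l * t ^+ 2).
  nra.
apply: le_trans (ler_sum _ (fun i _ => term i)).
rewrite !sumrB sumr_const card_ord -mulr_sumr -mulr_suml -/(S x) -/B.
rewrite -(mulr_natl (l ^+ 2 * t ^+ 4)).
have l0 : 0 <= l by rewrite divr_ge0// ltW.
have := ler_wpM2l (mulr_ge0 (mulr_ge0 (ler0n R 2) l0) (sqr_ge0 t)) (kS x).
rewrite -/t => H.
have -> : k ^+ 2 / (m%:R + 1) = l ^+ 2 * (m%:R + 1).
  by rewrite /l; field; rewrite gt_eqF.
have kl : k = l * (m%:R + 1) by rewrite /l divfK ?gt_eqF.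
have := mulr_ge0 (sqr_ge0 l) (sqr_ge0 (t ^+ 2)).
rewrite kl in H. nra.
Qed.

End PhaseRetrieval.

(** * Smoothness of the objective *)

Lemma phase_retrieval_L0L1_smooth (R : realType) n m
    (a : 'I_m -> 'rV[R]_n) (y : 'I_m -> R) (L1 : R) :
  (<<codom a>> = fullv)%VS -> 0 < L1 ->
  exists L0 : R, 0 < L0 /\ L0L1_smooth L0 L1 (phase_retrieval a y).
Proof.
move=> a_span L1_gt0.
have [A [B [A0 B0 hess_le]]] := hess_phase_retrieval_le a y.
have [c [D [c0 D0 grad_ge]]] := grad_phase_retrieval_ge y a_span.
(* beyond T the cubic L1 c t^3 dominates (A + L1 D) t^2 *)
pose T := 1 + (A + L1 * D) / (L1 * c).
have L1c : 0 < L1 * c by exact: mulr_gt0.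
have L1D : 0 <= L1 * D by rewrite mulr_ge0// ltW.
have T1 : 1 <= T by rewrite lerDl divr_ge0// ?addr_ge0// ltW.
have TE : A + L1 * D <= L1 * c * T.
  rewrite /T mulrDr mulr1 mulrCA divff ?gt_eqF// mulr1.
  by rewrite lerDr ltW.
have cubic t : 0 <= t ->
    A * t ^+ 2 + B <= A * T ^+ 2 + B + L1 * D * T + 1 + L1 * (c * t ^+ 3 - D * t).
  move=> t0; have [tT|/ltW Tt] := leP t T.
    have : A * t ^+ 2 <= A * T ^+ 2 by rewrite ler_wpM2l// ler_sqr// nnegrE (le_trans t0).
    have : L1 * D * t <= L1 * D * T by rewrite ler_wpM2l.
    have : 0 <= L1 * c * t ^+ 3 by rewrite mulr_ge0 ?exprn_ge0// ltW.
    by lra.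
  have t1 : 1 <= t by exact: le_trans T1 Tt.
  have : (A + L1 * D) * t ^+ 2 <= L1 * c * t ^+ 3.
    rewrite (exprS t 2) (mulrA (L1 * c)); apply: ler_wpM2r; first exact: sqr_ge0.
    by apply: (le_trans TE); rewrite ler_wpM2l// ltW.
  have : L1 * D * t <= L1 * D * t ^+ 2 by rewrite ler_wpM2l// expr2 ler_peMr.
  have : 0 <= A * T ^+ 2 by rewrite mulr_ge0 ?sqr_ge0.
  have : 0 <= L1 * D * T by rewrite mulr_ge0// (le_trans ler01).
  by lra.
exists (A * T ^+ 2 + B + L1 * D * T + 1).
have L0_gt0 : 0 < A * T ^+ 2 + B + L1 * D * T + 1.
  have T0 : 0 <= T by exact: le_trans ler01 T1.
  have := mulr_ge0 A0 (sqr_ge0 T); have := mulr_ge0 L1D T0; lra.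
split=> //; split=> [||| x]; [exact: ltW|exact: ltW|exact: phase_retrieval_C2|].
apply: (@le_trans _ _ (A * enorm x ^+ 2 + B)).
  by apply: spectral_norm_le => [u|]; [exact: hess_le|rewrite addr_ge0// mulr_ge0 ?sqr_ge0].
apply: le_trans (cubic _ (enorm_ge0 x)) _.
by rewrite lerD2l ler_wpM2l ?grad_ge// ltW.
Qed.

Lemma derive1_lipschitz_le (R : realType) (p : R -> R) (r K : R) :
  0 < r -> (forall s, 0 < s -> `|p s - p r| <= K * `|s - r|) ->
  derivable p r 1 -> `|derive1 p r| <= K.
Proof.
move=> r0 pK /cvg_ex[l pl].
have -> : derive1 p r = l by rewrite derive1E; exact: cvg_lim pl.
have cv : (fun t : R => `|t^-1 *: (p (t *: 1 + r) - p r)|) t @[t --> 0^'] --> `|l|.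
  exact: cvg_norm pl.
rewrite -(cvg_lim _ cv)//.
apply: limr_le; first by apply/cvg_ex; eexists; exact: cv.
near=> h; have h0 : h != 0 by near: h; exact: nbhs_dnbhs_neq.
have hr : `|h| < r by near: h; exact: dnbhs0_lt.
rewrite normrM normfV ler_pdivrMl ?normr_gt0// mulrC /= [h *: 1]mulr1.
rewrite -[in leRHS](addrK r h).
by apply: pK; move: hr; rewrite ltr_norml; lra.
Unshelve. all: by end_near. Qed.

(** The properties of the kernel's conjugate that strong convexity provides,
    on the half-line where it agrees with an even convex function.  The index
    [i] supplies a unit vector: in dimension 0 the kernel is only determined at
    0. *)
Lemma reference_conjugate_radial (R : realType) n (phi : 'rV[R]_n -> \bar R)
    (h : R -> \bar R) (i : 'I_n) :
  reference_function phi -> (forall t, (0 <= h t)%E) ->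
  (forall x, phi x = h (enorm x)) ->
  let hs y := fine (conjugate *%R h y) in
  let p := derive1 hs in
  exists K : R, [/\ 0 <= K,
    forall r : R, 0 < r -> derivable hs r 1,
    forall r : R, 0 <= r -> 0 <= hs r - hs 0 <= K * r ^+ 2,
    forall r : R, 0 < r -> 0 <= p r <= K * r &
    forall r s : R, 0 < r -> 0 < s -> `|p s - p r| <= K * `|s - r|].
Proof.
move=> [_ _ [mu [mu0 cvx]] _ phi0] h_ge0 phih hs p.
have h0 : h 0 = 0%E by rewrite -(enorm0 (n := n)) -phih phi0.
pose e : 'rV[R]_n := delta_mx 0 i.
have he s : h `|s| = phi (s *: e) by rewrite phih enormZ enorm_delta mulr1.
have mid s1 s2 b1 b2 : h `|s1| = b1%:E -> h `|s2| = b2%:E ->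
    (h `|(s1 + s2) / 2|%R <= ((b1 + b2) / 2 - mu / 8 * (s1 - s2) ^+ 2)%:E)%E.
  rewrite !he => H1 H2; have := strongly_convex_midpoint cvx H1 H2.
  rewrite -scalerDl -scalerBl enormZ enorm_delta mulr1 real_normK ?num_real//.
  by rewrite scalerA (mulrC 2^-1).
have [G [dG G0 quad GL]] := conjugate_kernel_C11 mu0 h_ge0 h0 mid.
have hs_near (r : R) : 0 < r -> \forall t \near r, hs `|t| = hs t.
  by move=> r0; near=> t; rewrite gtr0_norm//; near: t; exact: lt_nbhsr.
have hsG (r : R) : 0 < r -> is_derive r 1 hs (G r).
  by move=> r0; exact: near_eq_is_derive (hs_near r r0) (dG r).
have pG (r : R) : 0 < r -> p r = G r.
  by move=> r0; rewrite /p derive1E; apply: derive_val; exact: hsG.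
have muV : 0 < mu^-1 by rewrite invr_gt0.
exists (2 * mu^-1); split=> [|r r0|r r0|r r0|r s r0 s0].
- by rewrite mulr_ge0// ltW.
- by case: (hsG r r0).
- have := quad r; rewrite ger0_norm// => /andP[-> /le_trans]; apply.
  by rewrite ler_wpM2r ?sqr_ge0//; lra.
- by have := GL 0 r (ltW r0); rewrite G0 !subr0 pG.
- rewrite !pG//; wlog rs : r s r0 s0 / r <= s.
    move=> H; have [/H|/ltW/H] := leP r s; first exact.
    by rewrite distrC (distrC s); exact.
  have /andP[g0 g1] := GL r s rs.
  by rewrite ger0_norm// ger0_norm ?subr_ge0.
Unshelve. all: by end_near. Qed.

Lemma phase_retrieval_aniso_smooth (R : realType) n m
    (a : 'I_m -> 'rV[R]_n) (y : 'I_m -> R) (phi : 'rV[R]_n -> \bar R) (Lbar : R) :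
  (<<codom a>> = fullv)%VS -> reference_function phi -> condI phi -> 0 < Lbar ->
  exists L : R, 0 < L /\ aniso_smooth2 L Lbar phi (phase_retrieval a y).
Proof.
move=> a_span refphi condphi Lbar0.
have [[i]|n0] := pselect (inhabited 'I_n); last first.
  exists 1; split => // x; apply: lambda_max_le => [u|]; last by rewrite mul1r ltW.
  suff -> : u = 0 by rewrite mul0mx enorm0 mulr0.
  by apply/rowP => j; exfalso; apply: n0; exists.
have phi0 : phi 0 = 0%E by case: refphi.
have [h /= [[h_ge0 phih] p_decr [C2 [C2_0 limC2]] lim_p]] := condphi.
have h0 : h 0 = 0%E by rewrite -(enorm0 (n := n)) -phih phi0.
have /= [K [K0 hs_der hs_quad p_le p_lip]] :=
  reference_conjugate_radial i refphi h_ge0 phih.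
set hs := (fun y : R => fine _) in p_decr limC2 lim_p hs_der hs_quad p_le p_lip.
pose p := derive1 hs.
have phi_radial v : conj_fun phi v = hs (enorm v) by exact: conj_fun_radial.
have hess_le v u M : 0 <= M ->
  (v = 0 -> K <= M) -> (v != 0 -> `|p (enorm v) / enorm v| <= M) ->
  (v != 0 -> derivable p (enorm v) 1 -> `|derive1 p (enorm v)| <= M) ->
  enorm (u *m hess (conj_fun phi) v) <= M * enorm u.
  move=> M0 KM Mq Mc; apply: (hess_radial_le phi_radial hs_der hs_quad) => //.
  move=> v0 s s0; apply: le_trans (KM v0).
  have /andP[ps0 psK] := p_le s s0.
  by rewrite ger0_norm ?ler_pdivrMr// divr_ge0// ltW.
have [A [B [A0 B0 hessf_le]]] := hess_phase_retrieval_le a y.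
have [c [D [c0 D0 grad_ge]]] := grad_phase_retrieval_ge y a_span.
set f := phase_retrieval a y in hessf_le grad_ge *.
pose c' := c / (2 * Lbar).
have c'0 : 0 < c' by rewrite divr_gt0// mulr_gt0.
have [Y HY] : exists Y : R, forall r, Y < r ->
    r * derive1 p r <= C2 + 1 /\ - (C2 + 1) <= r * derive1 p r.
  move/cvgrPdist_le : limC2 => /(_ 1 ltr01)[Y [_ HY]]; exists Y => r /HY /=.
  by rewrite ler_norml => /andP[]; rewrite -/p; lra.
have [Z HZ] : exists Z : R, forall t, Z < t -> p (c' * t ^+ 3) / t <= 1.
  move/cvgrPdist_le : (lim_p (c' *: 'X^3)) => /(_ 1 ltr01)[Z [_ HZ]]; exists Z => t /HZ /=.
  by rewrite hornerZ hornerXn sub0r normrN => /(le_trans (ler_norm _)).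
(* beyond T: t > 1, half of the cubic bound of the gradient absorbs its linear
   part, and r and t lie in the ranges of HY and HZ *)
pose T := 1 + 2 * D / c + `|Y| / c' + `|Z|.
pose Q := Num.max (K * (A * T ^+ 2 + B)) ((C2 + 2) / c' * (A + B)).
have Q0 : 0 <= Q.
  by rewrite le_max mulr_ge0// addr_ge0// mulr_ge0 ?sqr_ge0.
have Q1 : 0 < (Q + 1) / Lbar by rewrite divr_gt0// ltr_wpDl.
exists ((Q + 1) / Lbar); split => // x.
rewrite divfK ?gt_eqF//; apply: (@le_trans _ _ Q); last by rewrite lerDl.
apply: lambda_max_le => // u; rewrite mulmxA.
set v := Lbar^-1 *: grad f x; set t := enorm x.
have t0 : 0 <= t by exact: enorm_ge0.
have AB0 : 0 <= A * t ^+ 2 + B by rewrite addr_ge0// mulr_ge0 ?sqr_ge0.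
suff [M [M0 MQ MP]] : exists M, [/\ 0 <= M, M * (A * t ^+ 2 + B) <= Q &
    enorm (u *m hess (conj_fun phi) v) <= M * enorm u].
  apply: (le_trans (hessf_le _ _)); rewrite -/t.
  apply: (@le_trans _ _ (M * (A * t ^+ 2 + B) * enorm u)).
    by rewrite (mulrC M) -mulrA; apply: ler_wpM2l.
  by apply: ler_wpM2r => //; exact: enorm_ge0.
have v_gt0 : v != 0 -> 0 < enorm v by rewrite lt_def enorm_eq0 enorm_ge0 andbT.
have [tT|Tt] := leP t T.
  exists K; split => //.
    rewrite le_max; apply/orP; left; rewrite ler_wpM2l// lerD2r ler_wpM2l//.
    by rewrite ler_sqr// nnegrE (le_trans t0).
  apply: hess_le => // v0.
    have /andP[ps0 psK] := p_le _ (v_gt0 v0).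
    by rewrite ger0_norm ?ler_pdivrMr ?v_gt0// divr_ge0// enorm_ge0.
  apply: derive1_lipschitz_le => [|s s0]; first exact: v_gt0.
  by apply: p_lip => //; exact: v_gt0.
have Dc0 : 0 <= 2 * D / c by rewrite divr_ge0 ?mulr_ge0// ltW.
have Yc0 : 0 <= `|Y| / c' by rewrite divr_ge0// ltW.
have t1 : 1 < t by apply: le_lt_trans Tt; rewrite /T; have := normr_ge0 Z; lra.
have tD : 2 * D / c < t by apply: le_lt_trans Tt; rewrite /T; have := normr_ge0 Z; lra.
have tY : `|Y| / c' < t by apply: le_lt_trans Tt; rewrite /T; have := normr_ge0 Z; lra.
have tZ : Z < t.
  by apply: le_lt_trans Tt; rewrite /T; have := ler_norm Z; lra.
have t_gt0 : 0 < t by exact: lt_trans t1.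
have tt3 : t <= t ^+ 3 by rewrite ler_eXnr// ltW.
have t23 : t ^+ 2 <= t ^+ 3 by rewrite ler_weXn2l// ltW.
set r := enorm v.
have r_ge : c' * t ^+ 3 <= r.
  rewrite /r /v enormZ gtr0_norm ?invr_gt0// ler_pdivlMl//.
  apply: le_trans (grad_ge x); rewrite -/t.
  have -> : Lbar * (c' * t ^+ 3) = c / 2 * t ^+ 3 by rewrite /c'; field; rewrite gt_eqF.
  move: tD; rewrite ltr_pdivrMr// => tD.
  have : 2 * D * t <= c * t ^+ 3.
    have : 2 * D * t <= t * c * t by rewrite ler_wpM2r// ltW.
    have : c * t ^+ 2 <= c * t ^+ 3 by rewrite ler_wpM2l// ltW.
    by lra.
  by lra.
have ct3 : 0 < c' * t ^+ 3 by rewrite mulr_gt0// exprn_gt0.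
have r0 : 0 < r by exact: lt_le_trans r_ge.
have rY : Y < r.
  apply: lt_le_trans r_ge; apply: (le_lt_trans (ler_norm Y)).
  move: tY; rewrite ltr_pdivrMr// mulrC => /lt_le_trans; apply.
  by rewrite ler_wpM2l// ltW.
have v0 : v != 0 by rewrite -enorm_eq0 gt_eqF.
have t2_gt0 : 0 < t ^+ 2 by rewrite exprn_gt0.
have t2V : 0 <= (t ^+ 2)^-1 by rewrite invr_ge0 ltW.
(* C2 + 2 dominates both the bound C2 + 1 on r k''(r) and the bound 1 on
   k'(c' t^3) / t *)
exists ((C2 + 2) / c' / t ^+ 2).
have C20 : 0 <= C2 + 2 by rewrite addr_ge0.
have M0 : 0 <= (C2 + 2) / c' / t ^+ 2 by rewrite mulr_ge0// divr_ge0// ltW.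
split => //.
  rewrite le_max; apply/orP; right.
  rewrite -[_ / t ^+ 2 * _]mulrA; apply: ler_wpM2l; first by rewrite divr_ge0// ltW.
  rewrite ler_pdivrMl// mulrDr mulrC lerD2l ler_peMl//.
  by rewrite expr_ge1// ltW.
apply: hess_le => // [v00|_|_ _]; first by rewrite v00 eqxx in v0.
- have /andP[ps0 psK] := p_le _ r0.
  rewrite ger0_norm; last by rewrite divr_ge0// ltW.
  apply: le_trans (p_decr _ _ ct3 r_ge) _; rewrite -/p.
  have := HZ t tZ; rewrite ler_pdivrMr// mul1r => pt.
  rewrite ler_pdivrMr//; apply: (le_trans pt).
  have -> : (C2 + 2) / c' / t ^+ 2 * (c' * t ^+ 3) = (C2 + 2) * t.
    by field; rewrite !gt_eqF.
  by rewrite ler_peMl//; lra.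
- have [H1 H2] := HY r rY.
  have -> : (C2 + 2) / c' / t ^+ 2 = (C2 + 2) * t / (c' * t ^+ 3).
    by field; rewrite !gt_eqF.
  rewrite ler_pdivlMr// -(gtr0_norm ct3) -normrM mulrC normrM gtr0_norm//.
  apply: (@le_trans _ _ (r * `|derive1 p r|)); first by rewrite ler_wpM2r.
  rewrite -{1}(gtr0_norm r0) -normrM.
  apply: (@le_trans _ _ (C2 + 1)); first by rewrite ler_norml H1 H2.
  by nra.
Qed.

Theorem theorem2p12 (R : realType) (n m : nat)
    (a : 'I_m -> 'rV[R]_n) (y : 'I_m -> R)
    (a_span : (<<codom a>> = fullv)%VS) :
  (forall L1 : R, 0 < L1 ->
     exists L0 : R, 0 < L0 /\ L0L1_smooth L0 L1 (phase_retrieval a y)) /\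
  (forall phi : 'rV[R]_n -> \bar R,
     reference_function phi -> condS phi -> condI phi ->
     forall Lbar : R, 0 < Lbar ->
     exists L : R, 0 < L /\ aniso_smooth2 L Lbar phi (phase_retrieval a y)).
Proof.
split=> [L1 L1_gt0|phi refphi _ condphi Lbar Lbar_gt0].
  exact: phase_retrieval_L0L1_smooth.
exact: phase_retrieval_aniso_smooth.
Qed.
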